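(* For $\lambda>0$ let $\mathcal E_n^\lambda$ be the solution operator of the OEDG method solving $u_t+\lambda f(u)_x=0$ on a fixed mesh with the same CFL number, namely $\mathcal E_n^\lambda(u_h^0)=u_\sigma^n$ at time $t_n^\lambda=n\tau_\lambda$, where $\tau_\lambda=\tau/\lambda$ is the time step size. Then $$\mathcal E_n^\lambda=\mathcal E_n\qquad\forall\lambda>0,$$ where $\mathcal E_n=\mathcal E_n^1$ is the solution operator of the OEDG method (with time step size $\tau$) solving $u_t+f(u)_x=0$.
   Context: Let $\Omega=\bigcup_jI_j$ be a bounded interval (with periodic boundary conditions) partitioned into cells $I_j=[x_{j-1/2},x_{j+1/2}]$ of length $h_j$, $k\ge1$, and $\mathbb V^k=\{v\in L^2(\Omega):v|_{I_j}\in\mathbb P^k(I_j)\ \forall j\}$. Write $v^\pm_{j+1/2}$ for right/left limits at $x_{j+1/2}$, $[\![v]\!]_{j+1/2}=v^+_{j+1/2}-v^-_{j+1/2}$, $\mathrm{avg}(v)=\frac1{|\Omega|}\int_\Omega v\,dx$. DG operator for a scalar flux $f$: $L_f:\mathbb V^k\to\mathbb V^k$ is defined by $$\int_{I_j}L_f(u_h)v\,dx=\int_{I_j}f(u_h)v_x\,dx-\hat f_{j+1/2}v^-_{j+1/2}+\hat f_{j-1/2}v^+_{j-1/2}\quad\forall v\in\mathbb V^k,\ \forall j,$$ where $\hat f_{j+1/2}=\hat f(u^-_{h,j+1/2},u^+_{h,j+1/2})$ is a numerical flux. The numerical flux used for the equation with flux $\lambda f$ is $\lambda\hat f$ (as for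 the upwind and local Lax--Friedrichs fluxes), so $L_{\lambda f}=\lambda L_f$. OEDG method for a flux $f$ with time step $\tau$: fix an explicit $s$-stage Runge--Kutta method with coefficients $c_{\ell m},d_{\ell m}$ ($0\le m\le\ell\le s-1$, $\sum_{m\le\ell}c_{\ell m}=1$). Start from $u_\sigma^0=u_h^0\in\mathbb V^k$; with $u_\sigma^{n,0}=u_\sigma^n$, for $\ell=0,\dots,s-1$, $$u_h^{n,\ell+1}=\sum_{0\le m\le\ell}\big(c_{\ell m}u_\sigma^{n,m}+\tau d_{\ell m}L_f(u_\sigma^{n,m})\big),\qquad u_\sigma^{n,\ell+1}=\mathcal F_\tau u_h^{n,\ell+1},$$ and $u_\sigma^{n+1}=u_\sigma^{n,s}$. The operator $\mathcal E_n$ maps $u_h^0$ to $u_\sigma^n$. OE operator: $\mathcal F_\tau u_h=u_\sigma(\cdot,\tau)$, where $u_\sigma(\cdot,\hat t)\in\mathbb V^k$ solves on each $I_j$ $$\frac{d}{d\hat t}\int_{I_j}u_\sigma v\,dx+\sum_{m=0}^k\beta_j\frac{\sigma_j^m(u_h)}{h_j}\int_{I_j}(u_\sigma-P^{m-1}u_\sigma)v\,dx=0\quad\forall v\in\mathbb P^k(I_j),\qquad u_\sigma(\cdot,0)=u_h,$$ with $P^m$ the $L^2$ projection onto $\mathbb V^m$ ($m\ge0$), $P^{-1}:=P^0$, $\beta_j=|f'(\overline u_j)|$ where $\overline u_j$ is the cell average of $u_h$ over $I_j$ (so for flux $\lambda f$, $\beta_j=\lambda|f'(\overline u_j)|$),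 and $\sigma_j^m(u_h)=0$ if $u_h\equiv\mathrm{avg}(u_h)$, otherwise $$\sigma_j^m(u_h)=\frac{(2m+1)h_j^m}{(2k-1)\,m!}\,\frac{|[\![\partial_x^mu_h]\!]_{j-1/2}|+|[\![\partial_x^mu_h]\!]_{j+1/2}|}{2\|u_h-\mathrm{avg}(u_h)\|_{L^\infty(\Omega)}} .$$ *)

(* Defs.v *)
From HB Require Import structures.
From mathcomp Require Import all_boot all_order all_algebra qpoly.
From mathcomp Require Import all_classical all_reals all_analysis.
Set Implicit Arguments.
Unset Strict Implicit.
Unset Printing Implicit Defensive.
Import Order.TTheory GRing.Theory Num.Theory.
Import numFieldNormedType.Exports.
Local Open Scope classical_set_scope.
Local Open Scope ring_scope.

(* Cell j : 'I_ncells is [node j, node j.+1]; the values node i with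
   i > ncells are irrelevant. *)
Record mesh (R : realType) := Mesh {
  ncells : nat;
  ncells_gt0 : (0 < ncells)%N;
  node : nat -> R;
  node_lt : forall j : 'I_ncells, node j < node j.+1
}.

Section DG.
Context {R : realType} (M : mesh R).

Notation mu := (@lebesgue_measure R).
Notation N := (ncells M).

Definition Omega : set R := `[node M 0, node M N].
Definition cell (j : 'I_N) : set R := `[node M j, node M j.+1].
Definition cell_len (j : 'I_N) : R := node M j.+1 - node M j.

(* V^k: since an element of V^k is a class in L^2(Omega), it is determined by
   its polynomial restrictions to the cells (which have positive length), and
   these are arbitrary polynomials of degree <= k. *)
Definition dgspace (k : nat) := {ffun 'I_N -> {poly_k.+1 R}}.

Definition piece {k} (v : dgspace k) (j : 'I_N) : {poly R} := v j.

Definition dgconst (k : nat) (c : R) : dgspace k :=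
  [ffun _ => npolyp k.+1 c%:P].

(* Representative of v as a function on the real line, zero outside Omega (its
   value at the nodes, where v is not defined, is the right limit). *)
Definition dgfun {k} (v : dgspace k) (x : R) : R :=
  \sum_(j < N) (piece v j).[x] * \1_(`[node M j, node M j.+1[%classic) x.

(* Limits at the interface x_{j+1/2}, i.e. the right end of cell j. The domain
   is periodic, so the cell on the right of the last one is the first one. *)
Definition trace_l (p : 'I_N -> {poly R}) (j : 'I_N) : R :=
  (p j).[node M j.+1].
Definition trace_r (p : 'I_N -> {poly R}) (j : 'I_N) : R :=
  (p (ordS j)).[node M (ordS j)].
Definition jump (p : 'I_N -> {poly R}) (j : 'I_N) : R :=
  trace_r p j - trace_l p j.

Definition avg {k} (v : dgspace k) : R :=
  (node M N - node M 0)^-1 * \int[mu]_(x in Omega) dgfun v x.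

Definition cell_avg {k} (v : dgspace k) (j : 'I_N) : R :=
  (cell_len j)^-1 * \int[mu]_(x in cell j) (piece v j).[x].

(* dgfun vanishes outside Omega, hence this is the norm of L^oo(Omega). *)
Definition Linfty_norm {k} (v : dgspace k) : R :=
  fine (Lnorm mu +oo%E (fun x => (dgfun v x)%:E)).

Definition is_L2proj {k} (m : nat) (u : dgspace k) (w : dgspace m) : Prop :=
  forall v : dgspace m,
    \int[mu]_(x in Omega) ((dgfun u x - dgfun w x) * dgfun v x) = 0.

(* Here, in DGop (for f continuous) and in OEop (for tau >= 0), the set under
   xget has exactly one element: L2 products with V^k are nondegenerate on each
   cell and the OE system is a linear ODE with constant coefficients. The
   default value 0 only makes the definitions total. *)
Definition L2proj {k} (m : nat) (u : dgspace k) : dgspace m :=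
  xget 0 [set w | is_L2proj u w].

Definition num_flux (fhat : R -> R -> R) {k} (u : dgspace k) (j : 'I_N) : R :=
  fhat (trace_l (piece u) j) (trace_r (piece u) j).

(* The interface x_{j-1/2} is the one at the right end of cell ord_pred j. *)
Definition is_DGop (f : R -> R) (fhat : R -> R -> R) {k}
    (u w : dgspace k) : Prop :=
  forall (v : dgspace k) (j : 'I_N),
    \int[mu]_(x in cell j) ((piece w j).[x] * (piece v j).[x]) =
      \int[mu]_(x in cell j) (f (piece u j).[x] * (deriv (piece v j)).[x])
      - num_flux fhat u j * trace_l (piece v) j
      + num_flux fhat u (ord_pred j) * trace_r (piece v) (ord_pred j).

Definition DGop (f : R -> R) (fhat : R -> R -> R) {k}
    (u : dgspace k) : dgspace k :=
  xget 0 [set w | is_DGop f fhat u w].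

Definition oe_beta (f : R -> R) {k} (u : dgspace k) (j : 'I_N) : R :=
  `|derive1 f (cell_avg u j)|.

Definition oe_sigma {k} (u : dgspace k) (m : nat) (j : 'I_N) : R :=
  let du := fun i : 'I_N => derivn m (piece u i) in
  if u == dgconst k (avg u) then 0
  else ((2 * m + 1)%:R * cell_len j ^+ m) / ((2 * k%:R - 1) * (m`!)%:R)
       * ((`|jump du (ord_pred j)| + `|jump du j|)
          / (2 * Linfty_norm (u - dgconst k (avg u)))).

(* us is the solution for times t >= 0. The convention P^{-1} := P^0 is
   implemented by the truncated predecessor m.-1. *)
Definition is_OEsol (f : R -> R) {k} (u : dgspace k)
    (us : R -> dgspace k) : Prop :=
  us 0 = u /\
  forall (j : 'I_N) (v : {poly_k.+1 R}),
    let mom t := \int[mu]_(x in cell j) ((piece (us t) j).[x] * v.[x]) in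
    mom t @[t --> 0^'+] --> mom 0 /\
    forall t : R, 0 < t ->
      derivable mom t 1 /\
      derive1 mom t
      + \sum_(m < k.+1)
          oe_beta f u j * oe_sigma u m j / cell_len j
          * \int[mu]_(x in cell j)
              (((piece (us t) j).[x] - (piece (L2proj m.-1 (us t)) j).[x])
               * v.[x])
      = 0.

Definition OEop (f : R -> R) (tau : R) {k} (u : dgspace k) : dgspace k :=
  xget 0 [set w | exists us, is_OEsol f u us /\ us tau = w].

End DG.

Record rk_method (R : realType) := RKMethod {
  rk_s : nat;
  rk_c : nat -> nat -> R;
  rk_d : nat -> nat -> R;
  rk_s_gt0 : (0 < rk_s)%N;
  rk_c_sum : forall l, (l < rk_s)%N -> \sum_(m < l.+1) rk_c l m = 1
}.

Section OEDG.
Context {R : realType} (M : mesh R) (k : nat) (rk : rk_method R).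
Variables (f : R -> R) (fhat : R -> R -> R) (tau : R).

(* The sequence u^{n,0}, ..., u^{n,l} of filtered stages started from u. *)
Fixpoint oedg_stages (u : dgspace M k) (l : nat) : seq (dgspace M k) :=
  if l is l'.+1 then
    let us := oedg_stages u l' in
    rcons us (OEop f tau
      (\sum_(m < l'.+1)
         (rk_c rk l' m *: us`_m
          + (tau * rk_d rk l' m) *: DGop f fhat us`_m)))
  else [:: u].

Definition oedg_step (u : dgspace M k) : dgspace M k :=
  (oedg_stages u (rk_s rk))`_(rk_s rk).

Definition oedg_op (n : nat) (u : dgspace M k) : dgspace M k :=
  iter n oedg_step u.

End OEDG.

Arguments oedg_op {R} M k rk f fhat tau n u.

(* Main.v *)
Require Import Defs.
From HB Require Import structures.
From mathcomp Require Import all_boot all_order all_algebra qpoly.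
From mathcomp Require Import all_classical all_reals all_analysis.
Import Order.TTheory GRing.Theory Num.Theory.
Import numFieldNormedType.Exports.
Local Open Scope classical_set_scope.
Local Open Scope ring_scope.

(** The DG operator is homogeneous in the pair (flux, numerical flux), so the
factor [lam] it produces cancels the one in the time step [tau / lam].  The
damping speed [oe_beta] is multiplied by [lam] while [oe_sigma] does not
depend on the flux, so the filter for the flux [lam * f] is the one for [f] run
[lam] times faster: [us] solves the filter ODE for [f] iff [t |-> us (lam * t)]
solves the one for [lam * f], and these agree at times [tau] and [tau / lam]. *)

Lemma integrable_segment {R : realType} (a b : R) (g : R -> R) :
  continuous g -> (@lebesgue_measure R).-integrable `[a, b] (EFin \o g).
Proof.
move=> gc; apply: continuous_compact_integrable; first exact: segment_compact.
exact: continuous_subspaceT.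
Qed.

Lemma finite_roots {R : idomainType} (p : {poly R}) :
  p != 0 -> finite_set [set x | root p x].
Proof.
(* An infinite root set would contain [size p] distinct roots, more than a nonzero [p] can have. *)
move=> p0; apply: contrapT => /(infinite_set_fset (size p))[B Bp sB].
have := max_poly_roots (rs := finmap.enum_fset B) p0.
rewrite ltnNge sB => H; suff: false by [].
apply: H; last exact: finmap.fset_uniq.
by apply/allP => x xB; apply: Bp.
Qed.

(** A nonnegative function with zero integral vanishes almost everywhere. If [p] were nonzero, the
    segment would be covered by that exceptional null set and the finitely many roots of [p * p],
    contradicting its positive length. *)
Lemma poly_eq0_integral_sqr {R : realType} (a b : R) (p : {poly R}) :
  a < b ->
  \int[@lebesgue_measure R]_(x in `[a, b]) (p.[x] * p.[x]) = 0 -> p = 0.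
Proof.
move=> ab ip0; apply/eqP/negP => /negP p0.
pose q : {poly R} := p * p.
have qc : continuous (horner q) by exact: continuous_horner.
have iq := integrable_segment a b _ qc.
have q0 : q != 0 by rewrite mulf_neq0.
have : (\int[@lebesgue_measure R]_(x in `[a, b]) `|(q.[x])%:E| = 0)%E.
  under eq_integral => x _ do
    rewrite abse_EFin ger0_norm ?hornerM -?expr2 ?sqr_ge0// expr2 -hornerM.
  rewrite -[LHS]fineK; last exact: integrable_fin_num iq.
  apply: congr1 (etrans _ ip0).
  by apply: eq_Rintegral => x _; rewrite hornerM.
have mq := measurable_int _ iq.
move=> iq0.
have ae_q0 := (ae_eq_integral_abs (@lebesgue_measure R) (measurable_itv _)
  mq).1 iq0.
have neg_roots : lebesgue_measure.-negligible [set x | root q x].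
  have cq := finite_set_countable (finite_roots _ q0).
  apply/negligibleP; last exact: countable_lebesgue_measure0.
  exact: countable_measurable.
have neg_ab : (@lebesgue_measure R).-negligible `[a, b].
  apply: negligibleS (negligibleU ae_q0 neg_roots) => x xab.
  have [qx|qx] := eqVneq q.[x] 0; [right; exact/rootP|left => /(_ xab)].
  by move=> -[] /eqP; rewrite (negPf qx).
have : (@lebesgue_measure R) `[a, b] = 0%E.
  by apply: measure_negligible neg_ab; exact: measurable_itv.
rewrite lebesgue_measure_itv/= lte_fin ab => -[] /eqP; rewrite subr_eq0.
by rewrite gt_eqF.
Qed.

Lemma dg_eq0_integral_cells {R : realType} {M : mesh R} {k : nat}
    (w : dgspace M k) :
  (forall (v : dgspace M k) (j : 'I_(ncells M)),
    \int[@lebesgue_measure R]_(x in cell j)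
      ((piece w j).[x] * (piece v j).[x]) = 0) ->
  w = 0.
Proof.
move=> w0; apply/ffunP => j; rewrite ffunE; apply/val_inj => /=.
(* The test function is [w] itself. *)
exact: poly_eq0_integral_sqr (node_lt j) (w0 w j).
Qed.

(** The right-hand side of the DG identity does not involve the candidate, so the difference of two
    candidates is orthogonal to every test function on each cell. This identifies the value chosen
    by [xget]. *)
Lemma is_DGop_unique {R : realType} {M : mesh R} {k : nat} (f : R -> R)
    (fhat : R -> R -> R) (u w w' : dgspace M k) :
  is_DGop f fhat u w -> is_DGop f fhat u w' -> w = w'.
Proof.
move=> uw uw'; apply/eqP; rewrite -subr_eq0; apply/eqP/dg_eq0_integral_cells.
move=> v j; have := uw v j; rewrite -uw' => /eqP; rewrite -subr_eq0 => /eqP <-.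
have ci (z : dgspace M k) : (@lebesgue_measure R).-integrable (cell j)
    (EFin \o (fun x => (piece z j).[x] * (piece v j).[x])).
  apply: integrable_segment => x.
  by apply: cvgM; apply: continuous_horner.
rewrite -RintegralB//; last exact: measurable_itv.
apply: eq_Rintegral => x _.
by rewrite /piece !ffunE /= hornerD hornerN mulrBl.
Qed.

Lemma is_DGopZ {R : realType} {M : mesh R} {k : nat} (f : R -> R)
    (fhat : R -> R -> R) (c : R) (u w : dgspace M k) :
  continuous f -> is_DGop f fhat u w ->
  is_DGop (fun x => c * f x) (fun a b => c * fhat a b) u (c *: w).
Proof.
move=> fc uw v j.
under eq_Rintegral => x _ do rewrite /piece !ffunE /= hornerZ -mulrA.
under [X in _ = X - _ + _]eq_Rintegral => x _ do rewrite -mulrA.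
rewrite !RintegralZl; first last.
- apply: integrable_segment => x; apply: cvgM; last exact: continuous_horner.
  by apply: cvg_comp; [exact: continuous_horner|exact: fc].
- exact: measurable_itv.
- by apply: integrable_segment => x; apply: cvgM; apply: continuous_horner.
- exact: measurable_itv.
by rewrite [X in c * X](uw v j) /num_flux mulrDr mulrBr !mulrA.
Qed.

Lemma DGopZ {R : realType} {M : mesh R} {k : nat} (f : R -> R)
    (fhat : R -> R -> R) (c : R) (u : dgspace M k) :
  continuous f -> c != 0 ->
  DGop (fun x => c * f x) (fun a b => c * fhat a b) u = c *: DGop f fhat u.
Proof.
move=> fc c0; rewrite [in RHS]/DGop; case: xgetP => [w _ uw|nouw].
  apply: xget_unique; first exact: is_DGopZ.
  by move=> w' /is_DGop_unique; apply; apply: is_DGopZ.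
(* With no DG image for [f], the right side is the default 0. The left side is too, since an image
   for the scaled flux, multiplied by [c^-1], would be one for [f]. *)
rewrite scaler0; apply: xgetPN => w uw; apply: (nouw (c^-1 *: w)) => /=.
have cfc : continuous (fun x => c * f x).
  by move=> x; apply: cvgM; [exact: cvg_cst|exact: fc].
have := is_DGopZ _ _ c^-1 _ _ cfc uw.
rewrite (_ : (fun x => _) = f); last by apply/funext => x; rewrite mulKf.
by rewrite (_ : (fun a b => _) = fhat)//; do 2 apply/funext => ?; rewrite mulKf.
Qed.

(** Carries the right continuity of the moments at time 0 through the change of time. *)
Lemma cvg_at_right0Ml {R : realType} (c : R) :
  0 < c -> c * t @[t --> 0^'+] --> (0 : R)^'+.
Proof.
move=> c0 A [e /= e0 eA]; exists (e / c) => /=; first exact: divr_gt0.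
move=> t /=; rewrite sub0r normrN => te t0.
apply: eA => /=; last by rewrite mulr_gt0.
by rewrite sub0r normrN normrM (gtr0_norm c0) mulrC -ltr_pdivlMr.
Qed.

Lemma is_OEsol_time_scale {R : realType} {M : mesh R} {k : nat} (f : R -> R)
    (c : R) (u : dgspace M k) (us : R -> dgspace M k) :
  (forall x, derivable f x 1) -> 0 < c -> is_OEsol f u us ->
  is_OEsol (fun x => c * f x) u (fun t => us (c * t)).
Proof.
move=> df c0 [us0 Hus]; split; first by rewrite mulr0.
move=> j v /=; have [cvg0 ode] := Hus j v; split.
  by rewrite mulr0; apply: cvg_comp cvg0; exact: cvg_at_right0Ml.
move=> t t0; have [dm eqm] := ode (c * t) (mulr_gt0 c0 t0).
have dc : derivable (fun x : R => c * x) t 1 by [].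
set mom := (X in derivable X (c * t) 1) in dm eqm.
split.
  have : derivable (mom \o (fun x => c * x)) t 1.
    apply/derivable1_diffP/differentiable_comp; exact/derivable1_diffP.
  exact.
have -> : derive1 (fun x => mom (c * x)) t = c * derive1 mom (c * t).
  rewrite -[LHS]/(derive1 (mom \o (fun x => c * x)) t) derive1_comp//.
  by rewrite derive1Ml// derive1_id mulr1 mulrC.
(* The damping sum gains its factor [c] from [oe_beta], the time derivative from the chain rule; the
   equation is thus [c] times the original one at time [c * t]. *)
under eq_bigr => m _ do
  rewrite /oe_beta derive1Ml// normrM (gtr0_norm c0) -!mulrA.
rewrite -mulr_sumr -mulrDr.
under eq_bigr => m _ do rewrite !mulrA.
by rewrite eqm mulr0.
Qed.

Lemma OEop_time_scale {R : realType} {M : mesh R} {k : nat} (f : R -> R)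
    (c tau : R) (u : dgspace M k) :
  (forall x, derivable f x 1) -> 0 < c ->
  OEop (fun x => c * f x) (tau / c) u = OEop f tau u.
Proof.
(* The two sets of candidate values coincide, so [xget] picks the same element. *)
move=> df c0; congr xget; apply/seteqP; split => w [us [Hus <-]].
  exists (fun t => us (c^-1 * t)); split; last by rewrite mulrC.
  (* Reading [f] as a rescaling of [c * f] by [c^-1] gives the converse inclusion from the same
     lemma. *)
  rewrite (_ : f = fun x => c^-1 * (c * f x)); last first.
    by apply/funext => x; rewrite mulKf// gt_eqF.
  apply: is_OEsol_time_scale Hus; last by rewrite invr_gt0.
  by move=> x; apply: derivableM.
exists (fun t => us (c * t)); split; first exact: is_OEsol_time_scale.
by rewrite mulrC divfK// gt_eqF.
Qed.

Theorem theorem2p10 (R : realType) (M : mesh R) (k : nat) (hk : (1 <= k)%N)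
    (rk : rk_method R) (f : R -> R) (fhat : R -> R -> R)
    (hf : forall x : R, derivable f x 1) (tau : R) (htau : 0 < tau)
    (n : nat) (lam : R) (hlam : 0 < lam) :
  oedg_op M k rk (fun x => lam * f x) (fun a b => lam * fhat a b)
    (tau / lam) n
  = oedg_op M k rk f fhat tau n.
Proof.
have lam0 : lam != 0 by rewrite gt_eqF.
have fc : continuous f.
  by move=> x; apply: differentiable_continuous; apply/derivable1_diffP.
have stages (u : dgspace M k) l :
    oedg_stages rk (fun x => lam * f x) (fun a b => lam * fhat a b)
      (tau / lam) u l = oedg_stages rk f fhat tau u l.
  (* The induction runs on the whole list of stages because each new stage combines all earlier
     ones. *)
  elim: l => [//|l IHl]; rewrite [LHS]/= [RHS]/= IHl.
  rewrite (OEop_time_scale _ _ _ _ hf hlam).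
  congr (rcons _ (OEop _ _ _)); apply: eq_bigr => m _.
  by rewrite (DGopZ _ _ _ _ fc lam0) scalerA mulrAC divfK.
by apply/funext => u; apply: eq_iter => w; rewrite /oedg_step stages.
Qed.
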